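(* Let $A$ be a Poisson algebra with Poisson bracket $\{\cdot,\cdot\}_A$ and let $\alpha,\delta:A\to A$ be $\mathbf{k}$-linear maps. The polynomial ring $A[x]$ is a Poisson algebra with a Poisson bracket $\{\cdot,\cdot\}$ extending $\{\cdot,\cdot\}_A$ and satisfying $$\{a,x\}=\alpha(a)x+\delta(a)\quad\text{for all }a\in A$$ if and only if $\alpha$ is a Poisson derivation of $A$ and $\delta$ is a derivation of $A$ such that $$\delta(\{a,b\}_A)-\{\delta(a),b\}_A-\{a,\delta(b)\}_A=\delta(a)\alpha(b)-\alpha(a)\delta(b)$$ for all $a,b\in A$.
   Context: $\mathbf{k}$ is an algebraically closed field of characteristic zero. A Poisson algebra is a commutative $\mathbf{k}$-algebra $A$ with a $\mathbf{k}$-bilinear map $\{\cdot,\cdot\}$ (Poisson bracket) such that $(A,\{\cdot,\cdot\})$ is a Lie algebra and $\{ab,c\}=a\{b,c\}+b\{a,c\}$ for all $a,b,c$. A derivation $\alpha$ on a Poisson algebra $A$ is a Poisson derivation if $\alpha(\{a,b\})=\{\alpha(a),b\}+\{a,\alpha(b)\}$ for all $a,b\in A$. *)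

(* Defs.v *)
From HB Require Import structures.
From mathcomp Require Import all_boot all_order all_algebra.
From mathcomp Require Import sesquilinear.

Set Implicit Arguments.
Unset Strict Implicit.
Unset Printing Implicit Defensive.

Import GRing.Theory.
Local Open Scope ring_scope.

Section Poisson.
Variables (k : fieldType).

Record is_lie_bracket (L : lmodType k) (br : {bilinear L -> L -> L}) : Prop :=
  IsLieBracket {
    lie_alternating : forall a, br a a = 0;
    lie_jacobi : forall a b c, br a (br b c) + br b (br c a) + br c (br a b) = 0
  }.

Record is_poisson_bracket (B : comAlgType k) (br : {bilinear B -> B -> B}) :
    Prop := IsPoissonBracket {
  poisson_lie : is_lie_bracket br;
  poisson_leibniz : forall a b c, br (a * b) c = a * br b c + b * br a c
}.

Definition is_derivation (B : comAlgType k) (d : {linear B -> B}) : Prop :=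
  forall a b, d (a * b) = a * d b + b * d a.

Definition is_poisson_derivation (B : comAlgType k)
    (br : {bilinear B -> B -> B}) (d : {linear B -> B}) : Prop :=
  is_derivation d /\ forall a b, d (br a b) = br (d a) b + br a (d b).

End Poisson.

(* The library makes {poly A} an algebra over A only; [kpoly A] is the same ring
   viewed as a k-algebra, with c in k acting through the image c%:A of c in A. *)
Section KPoly.
Variables (k : fieldType) (A : comAlgType k).

Definition kpoly : Type := {poly A}.

HB.instance Definition _ := GRing.ComNzRing.on kpoly.

Definition kpoly_scale (c : k) (p : kpoly) : kpoly :=
  (c%:A : A) *: (p : {poly A}).

Fact kpoly_scalerA c d p :
  kpoly_scale c (kpoly_scale d p) = kpoly_scale (c * d) p.
Proof. by rewrite /kpoly_scale !scalerA -scalerAl mul1r scalerA. Qed.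

Fact kpoly_scale1r : left_id 1 kpoly_scale.
Proof. by move=> p; rewrite /kpoly_scale !scale1r. Qed.

Fact kpoly_scalerDr : right_distributive kpoly_scale +%R.
Proof. by move=> c p q; rewrite /kpoly_scale scalerDr. Qed.

Fact kpoly_scalerDl p : {morph kpoly_scale^~ p : c d / c + d}.
Proof. by move=> c d; rewrite /kpoly_scale !scalerDl. Qed.

HB.instance Definition _ := GRing.Zmodule_isLmodule.Build k kpoly
  kpoly_scalerA kpoly_scale1r kpoly_scalerDr kpoly_scalerDl.

Fact kpoly_scalerAl (c : k) (p q : kpoly) : c *: (p * q) = (c *: p) * q.
Proof. exact: (@scalerAl A {poly A} c%:A p q). Qed.

HB.instance Definition _ := GRing.Lmodule_isLalgebra.Build k kpoly
  kpoly_scalerAl.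
HB.instance Definition _ := GRing.Lalgebra_isComAlgebra.Build k kpoly.

End KPoly.

(* Main.v *)
(* Write the bracket as {p, q} = P(p, q) + D(p) q' - D(q) p', where P extends
   {_, _}_A to coefficients, with X central, and D is the derivation of A[X]
   extending a |-> alpha(a) X + delta(a) with D(X) = 0.  It is antisymmetric and
   satisfies the Leibniz rule, so its Jacobiator is alternating and a derivation
   in each argument; it thus vanishes as soon as it vanishes on the generators
   (a, b, c) and (a, b, X).  The value at (a, b, X) is a polynomial of degree
   at most 1 in X, whose two coefficients are the compatibility conditions on
   alpha and delta. *)
Require Import Defs.
From HB Require Import structures.
From mathcomp Require Import all_boot all_order all_algebra.
From mathcomp Require Import sesquilinear.
From mathcomp Require Import ring.

Set Implicit Arguments.
Unset Strict Implicit.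
Unset Printing Implicit Defensive.

Import GRing.Theory.
Local Open Scope ring_scope.

(** * Elementary facts on additive maps, derivations and Lie brackets *)

Lemma morph_add0 (U V : zmodType) (f : U -> V) :
  {morph f : a b / a + b} -> f 0 = 0.
Proof. by move=> fD; apply: (addrI (f 0)); rewrite -fD !addr0. Qed.

Lemma leibniz1 (B : nzRingType) (d : B -> B) :
  (forall a b, d (a * b) = a * d b + b * d a) -> d 1 = 0.
Proof.
by move=> dM; apply: (addrI (d 1)); rewrite addr0 -[in RHS](mul1r 1) dM !mul1r.
Qed.

Lemma lie_antisym (k : fieldType) (L : lmodType k)
    (br : {bilinear L -> L -> L}) a b :
  is_lie_bracket br -> br a b = - br b a.
Proof.
case=> alt _; apply/eqP; rewrite -addr_eq0; apply/eqP.
by have := alt (a + b); rewrite linearDl !linearDr /= !alt addr0 add0r.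
Qed.

(** * The Jacobiator of an antisymmetric biderivation *)

Section Jacobiator.
Variables (B : comNzRingType) (br : B -> B -> B).
Hypothesis brDl : forall c, {morph br^~ c : a b / a + b}.
Hypothesis brC : forall a b, br a b = - br b a.
Hypothesis br_leibniz : forall a b c, br (a * b) c = a * br b c + b * br a c.

Definition jacobiator a b c := br a (br b c) + br b (br c a) + br c (br a b).

Lemma antisym_brDr a : {morph br a : b c / b + c}.
Proof. by move=> b c; rewrite brC brDl opprD -!brC. Qed.

Lemma antisym_brN a b : br a (- b) = - br a b.
Proof.
apply/eqP; rewrite -addr_eq0 -antisym_brDr addNr; apply/eqP.
exact: morph_add0 (antisym_brDr a).
Qed.

Lemma antisym_leibniz_r a b c : br a (b * c) = b * br a c + c * br a b.
Proof. by rewrite brC br_leibniz [br c a]brC [br b a]brC; ring. Qed.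

Lemma jacobiator_cycle a b c : jacobiator a b c = jacobiator b c a.
Proof. by rewrite /jacobiator; ring. Qed.

Lemma jacobiatorDl b c : {morph (fun a => jacobiator a b c) : x y / x + y}.
Proof. by move=> x y; rewrite /jacobiator !(brDl, antisym_brDr); ring. Qed.

(** Besides the two Jacobiators, the expansion leaves products of two brackets, such as
    [br d b * br c a] and [br a c * br d b]; antisymmetry cancels them in pairs. *)
Lemma jacobiator_leibniz a b c d :
  jacobiator (a * b) c d = a * jacobiator b c d + b * jacobiator a c d.
Proof.
rewrite /jacobiator !(br_leibniz, antisym_leibniz_r, antisym_brDr).
by rewrite [br b c]brC [br a c]brC !antisym_brN; ring.
Qed.

(** The terms [br a (br a b)] and [br a (br b a)] are opposite. Antisymmetry only makes twice
    [br a a] vanish, hence the separate hypothesis in arbitrary characteristic. *)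
Lemma jacobiator_diag a b : br a a = 0 -> jacobiator a a b = 0.
Proof.
move=> aa; have b0 := morph_add0 (antisym_brDr b).
by rewrite /jacobiator aa b0 [br b a]brC antisym_brN; ring.
Qed.

End Jacobiator.

(** * Reduction of the Jacobi identity to constants and ['X] *)

Lemma derivation_poly_eq0 (A : comNzRingType) (d : {poly A} -> {poly A}) :
    {morph d : p q / p + q} ->
    (forall p q, d (p * q) = p * d q + q * d p) ->
    (forall c, d c%:P = 0) -> d 'X = 0 ->
  forall p, d p = 0.
Proof.
move=> dD dM dC dX; elim/poly_ind=> [|p c dp]; first exact: dC.
by rewrite dD dM dC dX dp !mulr0 !addr0.
Qed.

Lemma jacobiator_poly_eq0 (A : comNzRingType)
    (br : {poly A} -> {poly A} -> {poly A}) :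
    (forall r, {morph br^~ r : p q / p + q}) ->
    (forall p q, br p q = - br q p) ->
    (forall p q r, br (p * q) r = p * br q r + q * br p r) ->
    br 'X 'X = 0 ->
    (forall a b c : A, jacobiator br a%:P b%:P c%:P = 0) ->
    (forall a b : A, jacobiator br a%:P b%:P 'X = 0) ->
  forall p q r, jacobiator br p q r = 0.
Proof.
move=> brD brC brM brXX JC JX.
(* The Jacobiator is a derivation in its first argument, so constants and ['X] suffice there; cyclic
   symmetry brings the other arguments to that place. *)
have ext q r : (forall a, jacobiator br a%:P q r = 0) ->
    jacobiator br 'X q r = 0 -> forall p, jacobiator br p q r = 0.
  apply: derivation_poly_eq0 => [p p'|p p'].
    exact: (jacobiatorDl brD brC q r).
  exact: jacobiator_leibniz.
(* Arguments are freed one at a time. A triple with two ['X] can be rotated so that they stand in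
   the first two places, where [br 'X 'X = 0] applies. *)
have J1 b c p : jacobiator br p b%:P c%:P = 0.
  by apply: (ext) => //; rewrite jacobiator_cycle.
have JXc c p : jacobiator br p 'X c%:P = 0.
  apply: (ext) => [a|]; first by rewrite -jacobiator_cycle.
  exact: jacobiator_diag.
have J2 c p q : jacobiator br p q c%:P = 0.
  by rewrite jacobiator_cycle; apply: (ext) => [b|]; rewrite -jacobiator_cycle.
(* A constant third argument is covered by [J2]. If it is ['X], the first argument is reduced in
   turn, and a constant there rotates back to [J2]. *)
move=> p q r; rewrite -jacobiator_cycle; apply: (ext) => [c|].
  by rewrite jacobiator_cycle.
rewrite jacobiator_cycle; apply: (ext) => [a|].
  by rewrite jacobiator_cycle.
by rewrite -jacobiator_cycle; apply: jacobiator_diag.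
Qed.

Lemma poly_affine_eq0 (A : nzRingType) (u v : A) :
  u%:P * 'X + v%:P = 0 -> u = 0 /\ v = 0.
Proof.
move=> /polyP uv0; have := uv0 0; have := uv0 1.
by rewrite !coefD !coefMX !coefC ?coef0 /= addr0 add0r.
Qed.

(** * Coefficientwise extension of maps from [A] to [A[X]] *)

Section PolyExtension.
Variable A : comNzRingType.
Implicit Types (f : A -> {poly A}) (p q : {poly A}).

(** Values lie in [{poly A}] rather than [A], so that [alpha a * X + delta a] can be extended and
    extensions can be nested. *)
Definition poly_ext f p : {poly A} := \sum_(i < size p) f p`_i * 'X^i.

(** Coefficients past the size contribute [f 0], whence the first hypothesis. A common bound [n]
    lets polynomials of different sizes be compared term by term. *)
Lemma poly_ext_widen f n p : f 0 = 0 -> (size p <= n)%N ->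
  poly_ext f p = \sum_(i < n) f p`_i * 'X^i.
Proof.
move=> f0 le_pn; rewrite /poly_ext (big_ord_widen n (fun i => f p`_i * 'X^i)) //.
rewrite big_mkcond; apply: eq_bigr => i _; case: ltnP => // le_pi.
by rewrite nth_default // f0 mul0r.
Qed.

Lemma eq_poly_ext f g : f =1 g -> poly_ext f =1 poly_ext g.
Proof. by move=> fg p; apply: eq_bigr => i _; rewrite fg. Qed.

Lemma poly_ext_funD f g p :
  poly_ext (fun a => f a + g a) p = poly_ext f p + poly_ext g p.
Proof. by rewrite -big_split; apply: eq_bigr => i _; rewrite mulrDl. Qed.

Lemma poly_ext_funMl r f p :
  poly_ext (fun a => r * f a) p = r * poly_ext f p.
Proof. by rewrite /poly_ext mulr_sumr; apply: eq_bigr => i _; rewrite mulrA. Qed.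

Lemma poly_extC f a : f 0 = 0 -> poly_ext f a%:P = f a.
Proof.
move=> f0; rewrite (poly_ext_widen f0 (size_polyC_leq1 a)).
by rewrite big_ord1 coefC eqxx mulr1.
Qed.

Lemma poly_extMX f p : f 0 = 0 -> poly_ext f (p * 'X) = poly_ext f p * 'X.
Proof.
move=> f0; have [->|p0] := eqVneq p 0.
  by rewrite mul0r (poly_extC _ f0) f0 mul0r.
rewrite /poly_ext size_mulX // big_ord_recl coefMX f0 mul0r add0r mulr_suml.
by apply: eq_bigr => i _; rewrite coefMX /= exprSr mulrA.
Qed.

Lemma poly_extZ f c p : f 0 = 0 -> (forall a, f (c * a) = c *: f a) ->
  poly_ext f (c *: p) = c *: poly_ext f p.
Proof.
move=> f0 fZ; rewrite (poly_ext_widen f0 (size_scale_leq c p)) /poly_ext.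
by rewrite scaler_sumr; apply: eq_bigr => i _; rewrite coefZ fZ scalerAl.
Qed.

Lemma poly_extD f p q : {morph f : a b / a + b} ->
  poly_ext f (p + q) = poly_ext f p + poly_ext f q.
Proof.
move=> fD; have f0 := morph_add0 fD.
rewrite (poly_ext_widen f0 (size_polyD p q)).
rewrite (poly_ext_widen f0 (leq_maxl (size p) (size q))).
rewrite (poly_ext_widen f0 (leq_maxr (size p) (size q))) -big_split.
by apply: eq_bigr => i _; rewrite coefD fD mulrDl.
Qed.

Lemma poly_ext_leibniz f p q : {morph f : a b / a + b} ->
    (forall a b, f (a * b) = a%:P * f b + b%:P * f a) ->
  poly_ext f (p * q) = p * poly_ext f q + q * poly_ext f p.
Proof.
move=> fD fM; have f0 := morph_add0 fD.
have extC0 : poly_ext f 0 = 0 by rewrite (poly_extC 0 f0).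
(* First [p] is a constant and [q] is built up by Horner's scheme, using the Leibniz rule of [f] on
   [A]; a second induction then builds up [p]. *)
have Cq a : poly_ext f (a%:P * q) = a%:P * poly_ext f q + q * f a.
  elim/poly_ind: q => [|q b IH]; first by rewrite !(mulr0, mul0r, extC0, addr0).
  rewrite mulrDr mulrA -polyCM !poly_extD // !poly_extMX // !poly_extC // IH fM.
  by ring.
elim/poly_ind: p => [|p a IH]; first by rewrite !(mulr0, mul0r, extC0, addr0).
rewrite mulrDl mulrAC !poly_extD // !poly_extMX // poly_extC // Cq IH.
by ring.
Qed.

End PolyExtension.

(** The two terms [alpha a * alpha b * X] cancel, leaving degree at most 1. Keeping [br] abstract
    lets the formula serve both a given bracket and the constructed one. *)
Lemma jacobiator_CCX (A : comNzRingType) (brA : A -> A -> A)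
    (alpha delta : A -> A) (br : {poly A} -> {poly A} -> {poly A}) (a b : A) :
    (forall r, {morph br^~ r : p q / p + q}) ->
    (forall p q, br p q = - br q p) ->
    (forall p q r, br (p * q) r = p * br q r + q * br p r) ->
    (forall a b, br a%:P b%:P = (brA a b)%:P) ->
    (forall a, br a%:P 'X = (alpha a)%:P * 'X + (delta a)%:P) ->
  jacobiator br a%:P b%:P 'X =
    (brA (alpha a) b + brA a (alpha b) - alpha (brA a b))%:P * 'X
    + (brA (delta a) b + brA a (delta b)
       + (delta a * alpha b - alpha a * delta b) - delta (brA a b))%:P.
Proof.
move=> brD brC brM brE brX.
have brMr p q r : br p (q * r) = q * br p r + r * br p q.
  exact: antisym_leibniz_r.
have brDr p q r : br p (q + r) = br p q + br p r by apply: antisym_brDr.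
have brNr p q : br p (- q) = - br p q by apply: antisym_brN.
rewrite /jacobiator brE [br 'X a%:P]brC [br 'X (brA a b)%:P]brC !brX.
rewrite brNr !brDr !brMr !brX [br b%:P (alpha a)%:P]brC.
rewrite [br b%:P (delta a)%:P]brC !brE.
by rewrite !(polyCD, polyCN, polyCM); ring.
Qed.

(** * The bracket on [A[X]] built from [brA], [alpha] and [delta] *)

Section OreBracket.
Variables (k : fieldType) (A : comAlgType k) (brA : {bilinear A -> A -> A}).
Hypothesis hA : is_poisson_bracket brA.
Variables alpha delta : {linear A -> A}.

(** This is the double sum of [brA p_i q_j] times [X^(i+j)]. Additivity and the Leibniz rule in [p]
    come from the inner [poly_ext]. *)
Definition coef_bracket (p q : {poly A}) : {poly A} :=
  poly_ext (fun c => poly_ext (fun a => (brA a c)%:P) p) q.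

Definition ore_derivation (p : {poly A}) : {poly A} :=
  poly_ext (fun a => (alpha a)%:P * 'X + (delta a)%:P) p.

Definition ore_bracket (p q : {poly A}) : {poly A} :=
  coef_bracket p q + ore_derivation p * q^`() - ore_derivation q * p^`().

Lemma coef_bracketC p q : coef_bracket p q = - coef_bracket q p.
Proof.
rewrite /coef_bracket /poly_ext -sumrN.
under eq_bigr do rewrite mulr_suml.
rewrite exchange_big; apply: eq_bigr => i _; rewrite mulr_suml -sumrN.
apply: eq_bigr => j _.
by rewrite (lie_antisym _ _ (poisson_lie hA)) polyCN mulrAC !mulNr.
Qed.

Lemma coef_bracketDl q : {morph coef_bracket^~ q : p p' / p + p'}.
Proof.
move=> p p'; rewrite /coef_bracket -poly_ext_funD; apply: eq_poly_ext => c.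
by apply: poly_extD => a b; rewrite linearDl polyCD.
Qed.

Lemma coef_bracket_leibniz p q r :
  coef_bracket (p * q) r = p * coef_bracket q r + q * coef_bracket p r.
Proof.
rewrite /coef_bracket -!poly_ext_funMl -poly_ext_funD; apply: eq_poly_ext => c.
apply: poly_ext_leibniz => a b; first by rewrite linearDl polyCD.
by rewrite (poisson_leibniz hA) polyCD !polyCM.
Qed.

(** Scaling by [c%:A] is the action of [k] on [kpoly A], so this is homogeneity over [k]; it rests
    on [c%:A * b = c *: b] in [A]. *)
Lemma coef_bracketZl (c : k) p q :
  coef_bracket (c%:A *: p) q = c%:A *: coef_bracket p q.
Proof.
rewrite -[RHS]mul_polyC /coef_bracket -poly_ext_funMl; apply: eq_poly_ext => a.
rewrite mul_polyC; apply: poly_extZ => [|b]; first by rewrite linear0l.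
by rewrite -scalerAl mul1r linearZl_LR -[in LHS]mulr_algl polyCM mul_polyC.
Qed.

Lemma coef_bracketCC a b : coef_bracket a%:P b%:P = (brA a b)%:P.
Proof.
have ext c : poly_ext (fun a => (brA a c)%:P) a%:P = (brA a c)%:P.
  by apply: poly_extC; rewrite linear0l.
by rewrite /coef_bracket (eq_poly_ext ext) poly_extC // linear0r.
Qed.

Lemma poisson_bracket1r a : brA a 1 = 0.
Proof.
rewrite (lie_antisym _ _ (poisson_lie hA)) (leibniz1 (d := brA^~ a)) ?oppr0 //.
by move=> b c; apply: poisson_leibniz.
Qed.

Lemma coef_bracket0 p : poly_ext (fun a => (brA a 0)%:P) p = 0.
Proof. by apply: big1 => i _; rewrite linear0r mul0r. Qed.

Lemma coef_bracketX p : coef_bracket p 'X = 0.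
Proof.
(* Writing ['X] as [1 * 'X] reduces the claim to the constant 1, whose bracket with every
   coefficient vanishes. *)
rewrite /coef_bracket -['X]mul1r poly_extMX ?poly_extC; last 2 first.
- exact: coef_bracket0.
- exact: coef_bracket0.
rewrite -[RHS](mul0r 'X); congr (_ * 'X).
by apply: big1 => i _; rewrite poisson_bracket1r mul0r.
Qed.

Lemma ore_bracketC p q : ore_bracket p q = - ore_bracket q p.
Proof. by rewrite /ore_bracket coef_bracketC; ring. Qed.

Hypothesis alpha_derivation : is_derivation alpha.
Hypothesis delta_derivation : is_derivation delta.

Lemma ore_derivationD : {morph ore_derivation : p q / p + q}.
Proof.
move=> p q; apply: poly_extD => a b.
by rewrite !linearD !polyCD; ring.
Qed.

Lemma ore_derivation_leibniz p q :
  ore_derivation (p * q) = p * ore_derivation q + q * ore_derivation p.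
Proof.
apply: poly_ext_leibniz => a b; first by rewrite !linearD !polyCD; ring.
by rewrite alpha_derivation delta_derivation !polyCD !polyCM; ring.
Qed.

Lemma ore_derivationZ (c : k) p :
  ore_derivation (c%:A *: p) = c%:A *: ore_derivation p.
Proof.
apply: poly_extZ => [|a]; first by rewrite !linear0 mul0r addr0.
have dZ (d : {linear A -> A}) : d (c%:A * a) = c%:A * d a.
  by rewrite !mulr_algl linearZ_LR.
by rewrite !dZ !polyCM -mul_polyC mulrDr mulrA.
Qed.

Lemma ore_derivationC a :
  ore_derivation a%:P = (alpha a)%:P * 'X + (delta a)%:P.
Proof. by apply: poly_extC; rewrite !linear0 mul0r addr0. Qed.

Lemma ore_derivationX : ore_derivation 'X = 0.
Proof.
rewrite -['X]mul1r /ore_derivation poly_extMX -/(ore_derivation _).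
  by rewrite ore_derivationC !leibniz1 // !(mul0r, addr0).
by rewrite !linear0 mul0r addr0.
Qed.

Lemma ore_bracketDl r : {morph ore_bracket^~ r : p q / p + q}.
Proof.
move=> p q; rewrite /ore_bracket coef_bracketDl ore_derivationD derivD.
by ring.
Qed.

Lemma ore_bracketZl (c : k) p q :
  ore_bracket (c%:A *: p) q = c%:A *: ore_bracket p q.
Proof.
rewrite /ore_bracket coef_bracketZl ore_derivationZ derivZ.
(* The scalar becomes an arbitrary element of [A], an atom for [ring]. *)
by move: (c%:A : A) => e; rewrite -!mul_polyC; ring.
Qed.

Lemma ore_bracket_leibniz p q r :
  ore_bracket (p * q) r = p * ore_bracket q r + q * ore_bracket p r.
Proof.
rewrite /ore_bracket coef_bracket_leibniz ore_derivation_leibniz derivM.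
by ring.
Qed.

Lemma ore_bracketCC (a b : A) : ore_bracket a%:P b%:P = (brA a b)%:P.
Proof.
by rewrite /ore_bracket coef_bracketCC !derivC !mulr0 subr0 addr0.
Qed.

Lemma ore_bracketX p : ore_bracket p 'X = ore_derivation p.
Proof.
by rewrite /ore_bracket coef_bracketX ore_derivationX derivX mulr1 mul0r
  subr0 add0r.
Qed.

Lemma ore_bracketXX : ore_bracket 'X 'X = 0.
Proof. by rewrite ore_bracketX ore_derivationX. Qed.

Hypothesis alpha_poisson : forall a b,
  alpha (brA a b) = brA (alpha a) b + brA a (alpha b).
Hypothesis delta_compat : forall a b : A,
  delta (brA a b) - brA (delta a) b - brA a (delta b)
  = delta a * alpha b - alpha a * delta b.

Lemma ore_bracket_jacobi p q r : jacobiator ore_bracket p q r = 0.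
Proof.
apply: jacobiator_poly_eq0 => [||||a b c|a b].
- exact: ore_bracketDl.
- exact: ore_bracketC.
- exact: ore_bracket_leibniz.
- exact: ore_bracketXX.
- rewrite /jacobiator !ore_bracketCC -!polyCD.
  by rewrite (lie_jacobi (poisson_lie hA)).
rewrite (jacobiator_CCX (brA := brA) (alpha := alpha) (delta := delta)).
- rewrite alpha_poisson subrr mul0r add0r -delta_compat.
  by rewrite -[RHS]polyC0; congr (_%:P); ring.
- exact: ore_bracketDl.
- exact: ore_bracketC.
- exact: ore_bracket_leibniz.
- exact: ore_bracketCC.
by move=> c; rewrite ore_bracketX ore_derivationC.
Qed.

End OreBracket.

(** * Bilinearity over [k] and the equivalence *)

Lemma ore_bracket_bilinear (k : fieldType) (A : comAlgType k)
    (brA : {bilinear A -> A -> A}) (alpha delta : {linear A -> A}) :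
    is_poisson_bracket brA ->
  bilinear_for *:%R *:%R
    (ore_bracket brA alpha delta : kpoly A -> kpoly A -> kpoly A).
Proof.
move=> hA; split=> [q c p p'|p c q q'].
  by rewrite [LHS]ore_bracketDl ore_bracketZl.
(* Linearity on the right is transported from the left by antisymmetry. *)
rewrite [LHS](ore_bracketC hA) ore_bracketDl ore_bracketZl opprD -scalerN.
by rewrite -!(ore_bracketC hA).
Qed.

Theorem theorem1p1 (k : closedFieldType) (char0 : [pchar k] =i pred0)
    (A : comAlgType k) (brA : {bilinear A -> A -> A})
    (hA : is_poisson_bracket brA) (alpha delta : {linear A -> A}) :
  (exists br : {bilinear kpoly A -> kpoly A -> kpoly A},
      [/\ is_poisson_bracket br,
          forall a b : A, br a%:P b%:P = (brA a b)%:P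
        & forall a : A, br a%:P 'X = (alpha a)%:P * 'X + (delta a)%:P])
  <->
  [/\ is_poisson_derivation brA alpha,
      is_derivation delta
    & forall a b : A,
        delta (brA a b) - brA (delta a) b - brA a (delta b)
        = delta a * alpha b - alpha a * delta b].
Proof.
split=> [[br [hbr brE brX]]|[[alphaM alphaP] deltaM compat]].
  have brM := poisson_leibniz hbr.
  (* The Leibniz rule for the bracket of [a * b] with ['X] equates two polynomials of degree at most
     1; the coefficient of [X] concerns [alpha], the constant one [delta]. *)
  have ader a b : alpha (a * b) - (a * alpha b + b * alpha a) = 0
      /\ delta (a * b) - (a * delta b + b * delta a) = 0.
    apply: poly_affine_eq0; have := brM a%:P b%:P 'X.
    rewrite -[_ * _ : kpoly A](polyCM a b) !brX => /eqP.
    rewrite -subr_eq0 => /eqP <-.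
    by rewrite !(polyCD, polyCN, polyCM); ring.
  have JX a b : brA (alpha a) b + brA a (alpha b) - alpha (brA a b) = 0
      /\ brA (delta a) b + brA a (delta b)
       + (delta a * alpha b - alpha a * delta b) - delta (brA a b) = 0.
    apply: poly_affine_eq0.
    rewrite -(jacobiator_CCX (br := br) (brA := brA)) //.
    - exact: (lie_jacobi (poisson_lie hbr)).
    - by move=> r p q; apply: linearDl.
    by move=> p q; apply: lie_antisym (poisson_lie hbr).
  split=> [|a b|a b].
  - split=> a b; apply/eqP; rewrite -subr_eq0; apply/eqP.
      by case: (ader a b).
    by rewrite -[LHS]opprK opprB (JX a b).1 oppr0.
  - by apply/eqP; rewrite -subr_eq0 (ader a b).2.
  (* The compatibility condition is the constant coefficient in [JX], up to sign. *)
  apply/eqP; rewrite -subr_eq0 -oppr_eq0 -[X in _ == X](JX a b).2; apply/eqP.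
  by ring.
pose br0 : kpoly A -> kpoly A -> kpoly A := ore_bracket brA alpha delta.
pose brB := bilinear_isBilinear.Build k (kpoly A) (kpoly A) (kpoly A)
  *:%R *:%R br0 (ore_bracket_bilinear alpha delta hA).
pose br : {bilinear kpoly A -> kpoly A -> kpoly A} :=
  HB.pack br0 brB.
exists br; split.
- split; last exact: (ore_bracket_leibniz hA alphaM deltaM).
  split=> [p|p q r]; last exact: (ore_bracket_jacobi hA).
  (* Antisymmetry gives twice [br0 p p] equal to 0; characteristic zero makes 2 nonzero in [k], so
     the bracket is alternating. *)
  have /eqP : br0 p p + br0 p p = 0.
    by apply/eqP; rewrite addr_eq0; apply/eqP; apply: (ore_bracketC hA).
  have /pcharf0P two_neq0 := char0.
  by rewrite -mulr2n -scaler_nat scaler_eq0 two_neq0 => /eqP.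
- exact: ore_bracketCC.
by move=> a; rewrite [LHS](ore_bracketX hA) ?ore_derivationC.
Qed.
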